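(* The generating function for grand Dyck paths with respect to their degree of symmetry is $$\sum_{n\ge0} \sum_{P\in\mathcal{GD}_n} s^{\mathrm{ds}(P)} z^n = \frac{1}{2(1-s)z + \sqrt{1-4z}}.$$
   Context: For $n\ge 0$, $\mathcal{GD}_n$ is the set of grand Dyck paths of semilength $n$: lattice paths in the plane from $(0,0)$ to $(2n,0)$ with steps $U=(1,1)$ and $D=(1,-1)$ (no positivity constraint). For $P\in\mathcal{GD}_n$, let $\bar p_1,\dots,\bar p_{2n}$ be its steps from left to right, viewed as segments in the plane. The path $P$ is symmetric in position $i\in\{1,\dots,n\}$ if the segments $\bar p_i$ and $\bar p_{2n+1-i}$ are mirror images of each other under reflection along the vertical line $x=n$. The degree of symmetry $\mathrm{ds}(P)$ is the number of $i\in\{1,\dots,n\}$ such that $P$ is symmetric in position $i$. The identity is between formal power series in $z$ with coefficients polynomials in $s$, with $\sqrt{1-4z}$ the formal power series with constant term $1$. *)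

(* Defs.v *)
From HB Require Import structures.
From mathcomp Require Import all_boot all_order all_algebra.
From mathcomp Require Import ring boolp classical_sets.

Set Implicit Arguments.
Unset Strict Implicit.
Unset Printing Implicit Defensive.

Import GRing.Theory.
Local Open Scope ring_scope.

(* [Fps a] stands for the series \sum_(n >= 0) a n * z ^ n.  The wrapper keeps *)
(* the Cauchy product apart from the pointwise product of functions.          *)
Record fps (R : Type) := Fps { fps_coef : nat -> R }.

Lemma fpsP (R : Type) (f g : fps R) : fps_coef f =1 fps_coef g <-> f = g.
Proof. by split=> [|-> //]; case: f g => a [b] /= /funext ->. Qed.

HB.instance Definition _ (R : Type) := gen_eqMixin (fps R).
HB.instance Definition _ (R : Type) := gen_choiceMixin (fps R).

Section FpsRing.
Variable R : comNzRingType.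
Implicit Types f g h : fps R.

Definition fpsC (c : R) : fps R := Fps (fun n => if n == 0%N then c else 0).
Definition fpsX : fps R := Fps (fun n => (n == 1%N)%:R).

Definition fps_add f g := Fps (fun n => fps_coef f n + fps_coef g n).
Definition fps_opp f := Fps (fun n => - fps_coef f n).
Definition fps_mul f g :=
  Fps (fun n => \sum_(i < n.+1) fps_coef f i * fps_coef g (n - i)%N).

Fact fps_addA : associative fps_add.
Proof. by move=> f g h; apply/fpsP => n /=; rewrite addrA. Qed.
Fact fps_addC : commutative fps_add.
Proof. by move=> f g; apply/fpsP => n /=; rewrite addrC. Qed.
Fact fps_add0 : left_id (fpsC 0) fps_add.
Proof. by move=> f; apply/fpsP => n /=; rewrite if_same add0r. Qed.
Fact fps_addN : left_inverse (fpsC 0) fps_opp fps_add.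
Proof. by move=> f; apply/fpsP => n /=; rewrite if_same addNr. Qed.

HB.instance Definition _ :=
  GRing.isZmodule.Build (fps R) fps_addA fps_addC fps_add0 fps_addN.

Definition fps_trunc (m : nat) f : {poly R} := \poly_(i < m.+1) fps_coef f i.

Lemma coef_fps_trunc m f n : (n <= m)%N -> (fps_trunc m f)`_n = fps_coef f n.
Proof. by move=> le_nm; rewrite coef_poly ltnS le_nm. Qed.

Lemma fps_mul_trunc m f g n : (n <= m)%N ->
  fps_coef (fps_mul f g) n = (fps_trunc m f * fps_trunc m g)`_n.
Proof.
move=> le_nm; rewrite coefM; apply: eq_bigr => i _.
by rewrite !coef_fps_trunc ?(leq_trans (leq_subr _ _)) ?(leq_trans (leq_ord i)).
Qed.

Fact fps_mulC : commutative fps_mul.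
Proof. by move=> f g; apply/fpsP=> n; rewrite !(@fps_mul_trunc n) // mulrC. Qed.

Fact fps_mulA : associative fps_mul.
Proof.
move=> f g h; apply/fpsP => n.
have -> : fps_coef (fps_mul f (fps_mul g h)) n =
    (fps_trunc n f * (fps_trunc n g * fps_trunc n h))`_n.
  rewrite coefM; apply: eq_bigr => i _.
  by rewrite coef_fps_trunc ?leq_ord // (@fps_mul_trunc n) ?leq_subr.
rewrite mulrA coefM; apply: eq_bigr => i _.
by rewrite (@fps_mul_trunc n) ?leq_ord // coef_fps_trunc ?leq_subr.
Qed.

Fact fps_mul1 : left_id (fpsC 1) fps_mul.
Proof.
move=> f; apply/fpsP => n /=; rewrite big_ord_recl /= mul1r subn0.
by rewrite big1 ?addr0 // => i _; rewrite mul0r.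
Qed.

Fact fps_mulDl : left_distributive fps_mul fps_add.
Proof.
move=> f g h; apply/fpsP => n /=; rewrite -big_split /=.
by apply: eq_bigr => i _; rewrite mulrDl.
Qed.

Fact fps_oneN0 : fpsC 1 != fpsC 0.
Proof.
apply/eqP => /(congr1 (fun f => fps_coef f 0)) /= /eqP.
by rewrite oner_eq0.
Qed.

HB.instance Definition _ := GRing.Zmodule_isComNzRing.Build (fps R)
  fps_mulA fps_mulC fps_mul1 fps_mulDl fps_oneN0.

Definition fps_unit : pred (fps R) := [pred f | `[< exists g, g * f = 1 >]].
Definition fps_inv f := xget f [set g | g * f = 1]%classic.

Fact fps_mulVf : {in fps_unit, left_inverse 1 fps_inv *%R}.
Proof.
move=> f /asboolP[g gf1].
by apply: (@xgetPex _ f [set g | g * f = 1]%classic); exists g.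
Qed.
Fact fps_unitP f g : g * f = 1 -> fps_unit f.
Proof. by move=> gf1; apply/asboolP; exists g. Qed.
Fact fps_inv_out : {in [predC fps_unit], fps_inv =1 id}.
Proof.
move=> f /asboolP nunit; rewrite /fps_inv xgetPN // => g gf1.
by apply: nunit; exists g.
Qed.

HB.instance Definition _ := GRing.ComNzRing_hasMulInverse.Build (fps R)
  fps_mulVf fps_unitP fps_inv_out.

(* The square root of f with constant term 1 (unique, see [fps_sqrt_uniq],    *)
(* when 2 is not a zero divisor in R); it is 0 if there is none.              *)
Definition fps_sqrt f : fps R :=
  xget 0 [set g | fps_coef g 0 = 1 /\ g ^+ 2 = f]%classic.

End FpsRing.

(* Well-definedness of the inverse and of the square root of 1 - 4 z.         *)
Section FpsTheory.
Variable R : comNzRingType.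
Implicit Types f g h : fps R.

Lemma fps_coefD f g n : fps_coef (f + g) n = fps_coef f n + fps_coef g n.
Proof. by []. Qed.

Lemma fps_coefN f n : fps_coef (- f) n = - fps_coef f n.
Proof. by []. Qed.

Lemma fps_coefM f g n :
  fps_coef (f * g) n = \sum_(i < n.+1) fps_coef f i * fps_coef g (n - i)%N.
Proof. by []. Qed.

Lemma fps_coef0 n : fps_coef (0 : fps R) n = 0.
Proof. exact: if_same. Qed.

Lemma fps_coef1 n : fps_coef (1 : fps R) n = (n == 0%N)%:R.
Proof. by case: n. Qed.

Lemma fps_coefXM f n :
  fps_coef (fpsX R * f) n = if n is m.+1 then fps_coef f m else 0.
Proof.
rewrite fps_coefM big_ord_recl /= mul0r add0r.
case: n => [|n]; first by rewrite big_ord0.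
rewrite big_ord_recl /= mul1r subSS subn0 big1 ?addr0 // => i _.
by rewrite mul0r.
Qed.

Lemma fps_rec (F : nat -> (nat -> R) -> R) :
  (forall n a b, (forall i, (i < n)%N -> a i = b i) -> F n a = F n b) ->
  exists a : nat -> R, forall n, a n = F n a.
Proof.
move=> Floc.
pose s := fix s n := if n is m.+1 then rcons (s m) (F m (nth 0 (s m))) else [::].
have size_s n : size (s n) = n by elim: n => //= n IH; rewrite size_rcons IH.
pose a n := nth 0 (s n.+1) n.
have aE n : a n = F n (nth 0 (s n)).
  by rewrite /a /= nth_rcons size_s ltnn eqxx.
have nth_s n i : (i < n)%N -> nth 0 (s n) i = a i.
  elim: n => // n IH; rewrite ltnS leq_eqVlt => /predU1P[-> //|lt_in].
  by rewrite /= nth_rcons size_s lt_in IH.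
by exists a => n; rewrite aE; apply: Floc => i /nth_s.
Qed.

Lemma fps_lreg f : GRing.lreg (fps_coef f 0) -> GRing.lreg f.
Proof.
move=> f0reg; apply: mulrI0_lreg => g fg0; apply/fpsP.
elim/ltn_ind => n IH; rewrite fps_coef0; apply: f0reg; rewrite mulr0.
have <- : fps_coef (f * g) n = 0 by rewrite fg0 fps_coef0.
rewrite fps_coefM big_ord_recl /= subn0 big1 ?addr0 // => i _.
rewrite IH ?fps_coef0 ?mulr0 //; case: n i {IH} => [[]|n i] //.
by rewrite /bump /= subSS ltnS leq_subr.
Qed.

Lemma fps_unit_coef0 f (c : R) :
  c * fps_coef f 0 = 1 -> f \is a GRing.unit.
Proof.
move=> cf0.
have [|a aE] := @fps_rec (fun n a =>
    c * ((n == 0%N)%:R - \sum_(i < n) fps_coef f i.+1 * a (n - i.+1)%N)).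
  move=> n a b ab; congr (_ * (_ - _)); apply: eq_bigr => i _.
  by rewrite ab //; case: n i {ab} => [[]|n i] //; rewrite subSS ltnS leq_subr.
apply: (@fps_unitP _ f (Fps a)); rewrite mulrC; apply/fpsP => n.
rewrite fps_coefM fps_coef1 big_ord_recl /= subn0 aE mulrA.
by rewrite [_ * c]mulrC cf0 mul1r subrK.
Qed.

Lemma fps_sqrt_uniq f g h : GRing.lreg (2 : R) ->
  fps_coef g 0 = 1 -> fps_coef h 0 = 1 -> g ^+ 2 = f -> h ^+ 2 = f -> g = h.
Proof.
move=> reg2 g0 h0 gf hf; apply: subr0_eq; apply: (@fps_lreg (g + h)).
  by rewrite fps_coefD g0 h0.
by rewrite mulr0 mulrC -subr_sqr gf hf subrr.
Qed.

Lemma fps_sqrt_1B4X : let f := 1 - 4 * fpsX R in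
  fps_coef (fps_sqrt f) 0 = 1 /\ fps_sqrt f ^+ 2 = f.
Proof.
move=> f; have [|a aE] := @fps_rec (fun n a =>
    if n is m.+1 then \sum_(i < m.+1) a i * a (m - i)%N else 1).
  move=> [//|n] a b ab; apply: eq_bigr => i _.
  by rewrite !ab // ltnS leq_subr.
have C_eq : Fps a = 1 + fpsX R * Fps a ^+ 2.
  apply/fpsP => n; rewrite fps_coefD fps_coef1 fps_coefXM /= aE.
  by case: n => [|n]; rewrite ?addr0 ?add0r.
apply: (@xgetPex _ 0 [set g | fps_coef g 0 = 1 /\ g ^+ 2 = f]%classic).
exists (1 - fpsX R * (2 * Fps a)); split.
  by rewrite fps_coefD fps_coefN fps_coefXM subr0.
rewrite /f; set C := Fps a in C_eq *; set x := fpsX R in C_eq *.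
have -> : (1 - x * (2 * C)) ^+ 2 = 1 - 4 * x * (C - x * C ^+ 2) by ring.
by rewrite {1}C_eq addrK mulr1.
Qed.

End FpsTheory.

(* [true] is the step U = (1, 1) and [false] is the step D = (1, -1).         *)
Definition step_height (u : bool) : int := if u then 1 else -1.

Definition path_vertex (p : seq bool) (k : nat) : int * int :=
  (k%:Z, \sum_(u <- take k p) step_height u).

Definition grand_dyck (n : nat) : {set n.*2.-tuple bool} :=
  [set p : n.*2.-tuple bool | path_vertex p n.*2 == (n.*2%:Z, 0)].

(* The i-th step of p, i >= 1, as a segment (left endpoint, right endpoint).  *)
Definition path_segment (p : seq bool) (i : nat) : (int * int) * (int * int) :=
  (path_vertex p i.-1, path_vertex p i).

Definition reflect_point (n : nat) (v : int * int) : int * int :=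
  (n.*2%:Z - v.1, v.2).

(* Reflecting along x = n exchanges the left and right endpoints.             *)
Definition reflect_segment (n : nat) (e : (int * int) * (int * int)) :=
  (reflect_point n e.2, reflect_point n e.1).

Definition symmetric_at (n : nat) (p : seq bool) (i : nat) : bool :=
  reflect_segment n (path_segment p i) == path_segment p (n.*2.+1 - i).

Definition degree_of_symmetry (n : nat) (p : n.*2.-tuple bool) : nat :=
  #|[set i : 'I_n | symmetric_at n p i.+1]|.

(* Main.v *)
(* Read a grand Dyck path simultaneously from both ends: the i-th step from   *)
(* the left and the i-th step from the right form a pair, and half the total  *)
(* rise of the first i pairs is a walk on the integers with steps +1, -1 and  *)
(* two kinds of 0.  The path returns to height 0 iff the walk ends at 0; then *)
(* the walk is half the height difference between the mirror vertices, so the *)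
(* symmetric positions are the steps 0 of the walk made at level 0.  The      *)
(* series W_d counting walks from d to 0 satisfy                              *)
(*    W_d = [d = 0] + z (W_(d+1) + W_(d-1) + 2 (if d = 0 then s else 1) W_d), *)
(* which determines them.  With u = z (1 + u)^2 we have                       *)
(* sqrt (1 - 4 z) = 1 - 2 z (1 + u), and W_d = u^|d| W_0 with                 *)
(* W_0 = 1 / (2 (1 - s) z + sqrt (1 - 4 z)) solves these equations.           *)
Require Import Defs.
From mathcomp Require Import all_boot all_order all_algebra.
From mathcomp Require Import zify ring.
Import GRing.Theory.
Local Open Scope ring_scope.

(** Folding a path at its middle turns the global condition of mirror symmetry into a local weight
    on a walk ([symmetric_at_fold], [sum_grand_dyck]). Removing the first step of the walk gives a
    linear system with a unique solution ([walk_series_uniq]). A geometric solution in [|d|] works: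
    away from level 0 the system is the quadratic equation of [u], and at level 0 it fixes the
    factor [D^-1]. *)

Definition pair_step (e : bool * bool) : int :=
  (e.1 && e.2)%:Z - (~~ e.1 && ~~ e.2)%:Z.

Lemma step_heightD (e : bool * bool) :
  step_height e.1 + step_height e.2 = 2 * pair_step e.
Proof. by case: e => [[] []]. Qed.

Definition pair_height (q : seq (bool * bool)) (i : nat) : int :=
  \sum_(e <- take i q) pair_step e.

Definition fold_path (q : seq (bool * bool)) : seq bool :=
  unzip1 q ++ rev (unzip2 q).

Definition unfold_path (n : nat) (p : seq bool) : seq (bool * bool) :=
  zip (take n p) (rev (drop n p)).

Lemma fold_pathK (q : seq (bool * bool)) : unfold_path (size q) (fold_path q) = q.
Proof.
rewrite /unfold_path /fold_path -{1 2}(size_map fst q) take_size_cat //.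
by rewrite drop_size_cat // revK zip_unzip.
Qed.

Lemma unfold_pathK (n : nat) (p : seq bool) :
  size p = n.*2 -> fold_path (unfold_path n p) = p.
Proof.
move=> sz_p; have sz : size (take n p) = size (rev (drop n p)).
  by rewrite size_rev size_drop size_takel sz_p; lia.
rewrite /fold_path /unfold_path unzip1_zip ?sz // unzip2_zip ?sz //.
by rewrite revK cat_take_drop.
Qed.

Lemma size_fold_path (n : nat) (q : n.-tuple (bool * bool)) :
  size (fold_path q) == n.*2.
Proof. by rewrite size_cat size_rev !size_map size_tuple addnn. Qed.

Lemma size_unfold_path (n : nat) (p : n.*2.-tuple bool) :
  size (unfold_path n p) == n.
Proof. by rewrite size_zip size_rev size_drop size_takel size_tuple; lia. Qed.

Definition fold_tuple (n : nat) (q : n.-tuple (bool * bool)) : n.*2.-tuple bool :=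
  Tuple (size_fold_path n q).

Definition unfold_tuple (n : nat) (p : n.*2.-tuple bool) : n.-tuple (bool * bool) :=
  Tuple (size_unfold_path n p).

Lemma fold_tuple_bij (n : nat) : bijective (@fold_tuple n).
Proof.
exists (@unfold_tuple n) => [q|p]; apply: val_inj => /=.
  by rewrite -{1}(size_tuple q) fold_pathK.
by rewrite unfold_pathK // size_tuple.
Qed.

Lemma sum_step_height_take (n i : nat) (q : n.-tuple (bool * bool)) : (i <= n)%N ->
  \sum_(u <- take i (fold_path q)) step_height u +
  \sum_(u <- drop (n.*2 - i) (fold_path q)) step_height u = 2 * pair_height q i.
Proof.
move=> le_in; have sz1 : size (unzip1 q) = n by rewrite size_map size_tuple.
have sz2 : size (unzip2 q) = n by rewrite size_map size_tuple.
rewrite /fold_path takel_cat ?sz1 // drop_cat sz1 ifF; last by lia.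
rewrite drop_rev sz2 big_rev /=.
have -> : (n - (n.*2 - i - n) = i)%N by lia.
rewrite -!map_take !big_map -big_split mulr_sumr /=.
by apply: eq_bigr => e _; rewrite step_heightD.
Qed.

(** The height at the mirror vertex is the final height, [2 * pair_height q n], minus the rise of
    the last [i] steps. *)
Lemma path_vertex_fold (n i : nat) (q : n.-tuple (bool * bool)) : (i <= n)%N ->
  (path_vertex (fold_path q) i).2 - (path_vertex (fold_path q) (n.*2 - i)).2 =
  2 * (pair_height q i - pair_height q n).
Proof.
move=> le_in; rewrite mulrBr -!sum_step_height_take //.
have split_at k : \sum_(u <- fold_path q) step_height u =
    \sum_(u <- take k (fold_path q)) step_height u +
    \sum_(u <- drop k (fold_path q)) step_height u.
  by rewrite -big_cat cat_take_drop.
have -> : (n.*2 - n = n)%N by lia.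
by rewrite -split_at (split_at (n.*2 - i)%N) /=; ring.
Qed.

Lemma fold_tuple_grand_dyck (n : nat) (q : n.-tuple (bool * bool)) :
  (fold_tuple n q \in grand_dyck n) = (pair_height q n == 0).
Proof.
have /eqP := path_vertex_fold n 0 q (leq0n n).
rewrite inE /path_vertex xpair_eqE eqxx /= subn0 take0 big_nil sub0r.
rewrite /pair_height take0 big_nil sub0r => /eqP.
lia.
Qed.

(** Abscissas always match under the reflection, so only the heights at the two endpoints matter;
    [path_vertex_fold] compares them. *)
Lemma symmetric_at_fold (n i : nat) (q : n.-tuple (bool * bool)) :
  (i < n)%N -> pair_height q n = 0 ->
  symmetric_at n (fold_path q) i.+1 =
  (pair_height q i == 0) && (pair_height q i.+1 == 0).
Proof.
move=> lt_in qn0.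
have := path_vertex_fold n i q (ltnW lt_in).
have := path_vertex_fold n i.+1 q lt_in.
rewrite qn0 /symmetric_at /path_segment /reflect_segment /reflect_point /path_vertex /=.
rewrite !xpair_eqE subSS subnS.
set a := \sum_(_ <- take i _) _; set b := \sum_(_ <- take i.+1 _) _.
set c := \sum_(_ <- take (_ - i) _) _; set d := \sum_(_ <- take _.-1 _) _.
move=> Eb Ea; lia.
Qed.

Section Walks.
Variables (R : comNzRingType) (s : R).

Definition level_weight (x y : int) : R := if (x == 0) && (y == 0) then s else 1.

Fixpoint walk_weight (d : int) (q : seq (bool * bool)) : R :=
  if q is e :: q' then level_weight d (d + pair_step e) * walk_weight (d + pair_step e) q'
  else (d == 0)%:R.

Lemma walk_weightE (d : int) (q : seq (bool * bool)) :
  walk_weight d q = (d + pair_height q (size q) == 0)%:R *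
    \prod_(i < size q) level_weight (d + pair_height q i) (d + pair_height q i.+1).
Proof.
elim: q d => [|e q IH] d /=.
  by rewrite big_ord0 mulr1 /pair_height big_nil addr0.
have pair_heightS i :
    d + pair_height (e :: q) i.+1 = d + pair_step e + pair_height q i.
  by rewrite /pair_height big_cons [LHS]addrA.
rewrite big_ord_recl IH mulrCA; congr (_%:R * (_ * _)).
- by rewrite -pair_heightS.
- by rewrite pair_heightS /pair_height !take0 !big_nil !addr0.
- by apply: eq_bigr => i _; rewrite -!pair_heightS.
Qed.

Lemma walk_weight_fold (n : nat) (q : n.-tuple (bool * bool)) :
  walk_weight 0 q =
  if fold_tuple n q \in grand_dyck n then s ^+ degree_of_symmetry (fold_tuple n q) else 0.
Proof.
rewrite walk_weightE size_tuple add0r fold_tuple_grand_dyck.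
case: eqP => [qn0|_]; last by rewrite mul0r.
rewrite mul1r /degree_of_symmetry cardsE -prodr_const [RHS]big_mkcond.
apply: eq_bigr => i _; rewrite !add0r.
by rewrite [_ \in _](symmetric_at_fold n i q (ltn_ord i) qn0).
Qed.

Lemma sum_walk_weight0 (d : int) :
  \sum_(q : 0.-tuple (bool * bool)) walk_weight d q = (d == 0)%:R.
Proof. by rewrite (big_pred1 [tuple]) // => q; apply/esym/eqP/tuple0. Qed.

Lemma sum_walk_weightS (n : nat) (d : int) :
  \sum_(q : n.+1.-tuple (bool * bool)) walk_weight d q =
  \sum_(e : bool * bool)
    level_weight d (d + pair_step e) *
    \sum_(q : n.-tuple (bool * bool)) walk_weight (d + pair_step e) q.
Proof.
under [RHS]eq_bigr do rewrite mulr_sumr.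
rewrite pair_big /=.
rewrite (reindex (fun x : (bool * bool) * n.-tuple (bool * bool) => cons_tuple x.1 x.2)) //=.
exists (fun q : n.+1.-tuple (bool * bool) => (thead q, behead_tuple q)) => [[e q] _|q _] /=.
  by congr pair; apply: val_inj.
by rewrite [RHS]tuple_eta; apply: val_inj.
Qed.

Lemma sum_grand_dyck (n : nat) :
  \sum_(P in grand_dyck n) s ^+ degree_of_symmetry P =
  \sum_(q : n.-tuple (bool * bool)) walk_weight 0 q.
Proof.
rewrite big_mkcond (reindex (@fold_tuple n)) /=; last exact/onW_bij/fold_tuple_bij.
by apply: eq_bigr => q _; rewrite walk_weight_fold.
Qed.

Lemma sum_pair_step (F : int -> R) :
  \sum_(e : bool * bool) F (pair_step e) = F 1 + F (-1) + 2 * F 0.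
Proof.
rewrite -(pair_bigA _ (fun a b => F (pair_step (a, b)))) /= !big_bool.
by rewrite /pair_step /=; ring.
Qed.

Lemma fps_coefCM (c : R) (f : fps R) (n : nat) :
  fps_coef (fpsC c * f) n = c * fps_coef f n.
Proof.
rewrite fps_coefM big_ord_recl /= subn0 big1 ?addr0 // => i _.
by rewrite mul0r.
Qed.

(** The factor [fpsX R] makes each coefficient depend only on the previous ones, so induction on
    [n], for all [d] at once, applies. *)
Lemma walk_series_uniq (W : int -> fps R) :
  (forall d, W d = (d == 0)%:R + fpsX R *
     (W (d + 1) + W (d - 1) + 2 * (fpsC (level_weight d d) * W d))) ->
  forall n d, fps_coef (W d) n = \sum_(q : n.-tuple (bool * bool)) walk_weight d q.
Proof.
move=> WE; have coef_nat (b : bool) n : fps_coef (b%:R : fps R) n = (b && (n == 0))%:R.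
  by case: b; rewrite ?fps_coef1 ?fps_coef0.
elim=> [|n IH] d; rewrite WE fps_coefD fps_coefXM coef_nat.
  by rewrite andbT addr0 sum_walk_weight0.
rewrite andbF add0r sum_walk_weightS.
rewrite (sum_pair_step (fun x => level_weight d (d + x) *
  \sum_(q : n.-tuple _) walk_weight (d + x) q)) -!IH addr0.
rewrite /level_weight !mulr_natl mulr2n !fps_coefD !fps_coefCM.
(* A step of +1 or -1 never stays at level 0, so its weight is 1. *)
have -> : (d == 0) && (d + 1 == 0) = false by lia.
have -> : (d == 0) && (d - 1 == 0) = false by lia.
by rewrite !mul1r mulr2n.
Qed.

End Walks.

(** Here [1 + u] is the Catalan series; regularity of 2 singles out the square root with constant
    term 1. *)
Lemma fps_sqrt_1B4X_param (R : comNzRingType) : GRing.lreg (2 : R) ->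
  exists u : fps R, u = fpsX R * (1 + u) ^+ 2 /\
    fps_sqrt (1 - 4 * fpsX R) = 1 - fpsX R * (2 * (1 + u)).
Proof.
move=> reg2; have [|a aE] := @fps_rec R (fun n a =>
    if n is m.+1 then fps_coef ((1 + Fps a) ^+ 2) m else 0).
  move=> [//|n] a b ab; rewrite !expr2 !fps_coefM; apply: eq_bigr => i _.
  by rewrite !fps_coefD /= !ab // ltnS ?leq_subr // -ltnS.
have uE : Fps a = fpsX R * (1 + Fps a) ^+ 2.
  by apply/fpsP => n; rewrite fps_coefXM /= aE.
exists (Fps a); split=> //; have [sqrt0 sqrtE] := fps_sqrt_1B4X R.
apply: fps_sqrt_uniq sqrtE _ => //.
  by rewrite fps_coefD fps_coefN fps_coefXM fps_coef1 subr0.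
set u := Fps a in uE *; set x := fpsX R in uE *.
have -> : (1 - x * (2 * (1 + u))) ^+ 2 = 1 - 4 * x * (1 + u - x * (1 + u) ^+ 2) by ring.
by rewrite -uE addrK mulr1.
Qed.

Lemma grand_dyck_symmetry_series (R : comNzRingType) (s : R) : GRing.lreg (2 : R) ->
  Fps (fun n => \sum_(P in grand_dyck n) s ^+ degree_of_symmetry P) =
  1 / (2 * (1 - fpsC s) * fpsX R + fps_sqrt (1 - 4 * fpsX R)).
Proof.
move=> reg2; have [u [uE sqrtE]] := fps_sqrt_1B4X_param R reg2.
set D := _ + fps_sqrt _; have D_unit : D \is a GRing.unit.
  apply: (fps_unit_coef0 (c := 1)); rewrite mul1r fps_coefD [_ * (1 - _) * _]mulrC.
  by rewrite fps_coefXM (fps_sqrt_1B4X R).1 add0r.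
set x := fpsX R in uE sqrtE; pose c := fpsC s.
have DE : D = 1 - 2 * x * (u + c) by rewrite /D sqrtE -/x -/c; ring.
apply/fpsP => n; rewrite [LHS]sum_grand_dyck.
pose W (d : int) : fps R := D^-1 * u ^+ `|d|%N.
rewrite -(walk_series_uniq R s W) => [|d]; first by rewrite /W expr0 mulr1 div1r.
(* This is the equation at level 0, where both neighbours contribute [u * D^-1]. *)
have DVE : D^-1 = 1 + x * (2 * (u + c)) * D^-1.
  by rewrite -[X in X + _](divrr D_unit) -mulrDl -[LHS]mul1r DE; congr (_ * _); ring.
rewrite /W /level_weight andbb -/x; case: (eqVneq d 0) => [->|d_neq0].
  by rewrite !expr0 !expr1 mulr1n -/c {1}DVE; ring.
rewrite [fpsC 1](_ : _ = 1) // add0r.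
have [k dk] : exists k, `|d|%N = k.+1 by exists (`|d|%N.-1); lia.
(* The sign of [d] decides which neighbour is nearer to 0; the equation is symmetric in the two. *)
rewrite dk; have : (`|(d + 1)%R|, `|(d - 1)%R|)%N \in [:: (k.+2, k); (k, k.+2)].
  by rewrite !inE !xpair_eqE; lia.
have {1}-> : u ^+ k.+1 = x * (1 + u) ^+ 2 * u ^+ k by rewrite exprS -uE.
by rewrite !inE => /orP[] /eqP[-> ->]; rewrite !exprS; ring.
Qed.

Theorem theorem3p1 :
  Fps (fun n : nat =>
    \sum_(P in grand_dyck n) ('X : {poly int}) ^+ degree_of_symmetry P) =
  1 / (2 * (1 - fpsC ('X : {poly int})) * fpsX {poly int}
       + fps_sqrt (1 - 4 * fpsX {poly int})).
Proof.
apply: grand_dyck_symmetry_series; apply/lregP.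
by rewrite -polyC_natr polyC_eq0.
Qed.
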